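(* Let $G^{(1)}_\pm$ and $G^{(2)}_\pm$ be signed graphs (half-loops allowed) with the same underlying multigraph $G=(V,E)$, with $G$ connected, and let $\tilde G_\pm=\mathrm{Double}(G^{(1)}_\pm,G^{(2)}_\pm)$. In the case that $\tilde G_\pm$ is connected and balanced, assume moreover that $G^{(1)}_\pm$ has no negative edges. Then the maps induced by $\pi_{(1)}^t:\mathbb{Z}^V\to\mathbb{Z}^{\tilde V}$ and $\pi_{(2)}:\mathbb{Z}^{\tilde V}\to\mathbb{Z}^V$ fit in a short complex $$0\longrightarrow K(G^{(1)}_\pm)\overset{\pi_{(1)}^t}{\longrightarrow}K(\tilde G_\pm)\overset{\pi_{(2)}}{\longrightarrow}K(G^{(2)}_\pm)\longrightarrow 0$$ with the following properties: (Case 3) if $\tilde G_\pm$ has two connected components, then the complex is split exact; (Case 2) if $\tilde G_\pm$ is connected and balanced, then the complex is short exact; (Case 1) if $\tilde G_\pm$ is connected and unbalanced, then the complex is exact at the two ends, and its homology at the middle term is $\mathbb{Z}/2\mathbb{Z}$. In particular, in every case, for all odd primes $p$ one has $$\mathrm{Syl}_p\,K(\tilde G_\pm)\cong\mathrm{Syl}_p\,K(G^{(1)}_\pm)\oplus\mathrm{Syl}_p\,K(G^{(2)}_\pm).$$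
   Context: Signed graphs: a multigraph with half-loops $G=(V,E)$ is a finite undirected multigraph (multiple edges and self-loops allowed) in which some of the self-loops are designated as half-loops; the other self-loops are full loops. A signed graph $G_\pm$ is such a $G$ together with a map $\beta:E\to\{+1,-1\}$. Orient the edges arbitrarily. Define $\partial,\delta:\mathbb{Z}^E\to\mathbb{Z}^V$ by $\partial(e)=u-\beta(e)v$ for every edge $e$ directed from $u$ to $v$, including $u=v$ (so positive loops and positive half-loops map to $0$, and negative loops and negative half-loops at $v$ map to $2v$); and $\delta(e)=\partial(e)$ for all $e$ except that $\delta(e)=v$ when $e$ is a negative half-loop at $v$. The signed graph Laplacian is $L(G_\pm)=\partial\delta^t$, and the critical group is the finite abelian group $K(G_\pm):=\operatorname{im}\partial/\operatorname{im}\partial\delta^t\cong\mathbb{Z}^E/(\operatorname{im}\delta^t+\ker\partial)$. A cycle (possibly a single full loop or half-loop) is balanced if it has an even number of negative edges, unbalanced otherwise. A signed graph is balanced if it has no unbalanced cycle, and unbalanced otherwise. Double covers: given $G^{(1)}_\pm,G^{(2)}_\pm$ on the same underlying $G=(V,E)$, the signed graph $\tilde G_\pm=\mathrm{Double}(G^{(1)}_\pm,G^{(2)}_\pm)$ has vertex set $\tilde V=\{v_+,v_-\}_{v\in V}$ and the following edges, each with the same sign as $e$ in $G^{(1)}_\pm$. For each $e=(u,v)\in E$ that is not a half-loop ($u=v$ allowed): two full edges $e_+=(u_+,v_+),e_-=(u_-,v_-)$ if $G^{(1)}_\pm,G^{(2)}_\pm$ agree on the sign of $e$, and $e_+=(u_+,v_-),e_-=(u_-,v_+)$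 if they disagree. For each half-loop $e$ at $v$: two half-loops $e_+$ at $v_+$ and $e_-$ at $v_-$ if the signs agree, and a single edge $\tilde e=(v_+,v_-)$ if they disagree. When $G$ is connected, $\tilde G$ has at most two connected components. Maps: $\pi_{(1)}:\mathbb{Z}^{\tilde V}\to\mathbb{Z}^V$, $v_\pm\mapsto v$; $\pi_{(2)}:\mathbb{Z}^{\tilde V}\to\mathbb{Z}^V$, $v_+\mapsto v$, $v_-\mapsto -v$; transposes $\pi_{(1)}^t(v)=v_++v_-$, $\pi_{(2)}^t(v)=v_+-v_-$. These induce homomorphisms $\pi_{(i)}:K(\tilde G_\pm)\to K(G^{(i)}_\pm)$ and $\pi_{(i)}^t:K(G^{(i)}_\pm)\to K(\tilde G_\pm)$ (using $K=\operatorname{im}\partial/\operatorname{im}L$). $\mathrm{Syl}_p A$ denotes the $p$-primary component of a finite abelian group $A$. *)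

(* Defs.v *)
From HB Require Import structures.
From mathcomp Require Import all_boot all_order all_algebra.
From mathcomp Require Import ring.
From mathcomp Require Import boolp.

Set Implicit Arguments.
Unset Strict Implicit.
Unset Printing Implicit Defensive.

Import GRing.Theory.
Local Open Scope ring_scope.
Local Open Scope quotient_scope.

Section SubOf.
Variables (A : zmodType) (S : zmodClosed A).

Record sub_of : Type := SubOf { sub_val : A; sub_valP : sub_val \in S }.

HB.instance Definition _ := [isSub for sub_val].
HB.instance Definition _ := [Choice of sub_of by <:].
HB.instance Definition _ := [SubChoice_isSubZmodule of sub_of by <:].

Lemma sub_val_is_zmod_morphism : zmod_morphism sub_val.
Proof. exact: (raddfB (val : sub_of -> A)). Qed.
HB.instance Definition _ :=
  GRing.isZmodMorphism.Build sub_of A sub_val sub_val_is_zmod_morphism.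

Lemma sub_val_inj : injective sub_val.
Proof. exact: val_inj. Qed.
End SubOf.

Section Image.
Variables (A B : zmodType) (f : {additive A -> B}).

Definition im : {pred B} := fun y => `[< exists x, f x = y >].

Lemma imP y : reflect (exists x, f x = y) (y \in im).
Proof. exact: asboolP. Qed.

Lemma im_zmod_closed : zmod_closed im.
Proof.
split=> [|_ _ /imP[x <-] /imP[y <-]]; apply/imP.
  by exists 0; rewrite raddf0.
by exists (x - y); rewrite raddfB.
Qed.
HB.instance Definition _ := GRing.isZmodClosed.Build B im im_zmod_closed.

Definition ker : {pred A} := fun x => f x == 0.

Lemma ker_zmod_closed : zmod_closed ker.
Proof.
split=> [|x y]; rewrite !unfold_in /ker ?raddf0 // raddfB => /eqP-> /eqP->.
by rewrite subr0.
Qed.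
HB.instance Definition _ := GRing.isZmodClosed.Build A ker ker_zmod_closed.
End Image.

Section Subquotient.
Variables (A : zmodType) (S T : zmodClosed A).

Definition within : {pred (sub_of S)} := fun x => sub_val x \in T.

Lemma within_zmod_closed : zmod_closed within.
Proof.
have inW x : (x \in within) = (sub_val x \in T) by [].
split=> [|x y]; rewrite !inW; first by rewrite raddf0 rpred0.
by rewrite raddfB; apply: rpredB.
Qed.
HB.instance Definition _ :=
  GRing.isZmodClosed.Build (sub_of S) within within_zmod_closed.

(* [S / (S :&: T)]; it is only used when [T] is contained in [S]. *)
Definition subquot : zmodType := Quotient.quot within.

Definition cls (x : sub_of S) : subquot := \pi_(Quotient.quot within) x.

Lemma cls_is_zmod_morphism : zmod_morphism cls.
Proof. exact: (raddfB \pi_(Quotient.quot within)). Qed.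
HB.instance Definition _ :=
  GRing.isZmodMorphism.Build (sub_of S) subquot cls cls_is_zmod_morphism.

Lemma cls_eq x y : (cls x == cls y) = (sub_val x - sub_val y \in T).
Proof.
by rewrite -raddfB; apply/esym; exact: (Quotient.idealrBE within).
Qed.

Lemma cls_surj (c : subquot) : cls (repr (c : Quotient.quot within)) = c.
Proof. exact: reprK. Qed.
End Subquotient.

Section Induced.
Variables (A B : zmodType) (phi : {additive A -> B}).
Variables (S T : zmodClosed A) (S' T' : zmodClosed B).
Hypothesis phiS : forall x, x \in S -> phi x \in S'.
Hypothesis phiT : forall x, x \in T -> phi x \in T'.

Definition restr (x : sub_of S) : sub_of S' := SubOf (phiS (sub_valP x)).

Definition induced_fun (c : subquot S T) : subquot S' T' :=
  cls T' (restr (repr (c : Quotient.quot (within T)))).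

Lemma induced_fun_cls x : induced_fun (cls T x) = cls T' (restr x).
Proof.
apply/eqP; rewrite cls_eq /= -raddfB; apply: phiT.
by rewrite -cls_eq cls_surj.
Qed.

Lemma induced_is_zmod_morphism : zmod_morphism induced_fun.
Proof.
move=> c d; rewrite -(cls_surj c) -(cls_surj d) -raddfB !induced_fun_cls -raddfB.
congr (cls _ _); apply: sub_val_inj.
by rewrite raddfB /= !raddfB.
Qed.
HB.instance Definition _ :=
  GRing.isZmodMorphism.Build _ _ induced_fun induced_is_zmod_morphism.

Definition induced : {additive subquot S T -> subquot S' T'} := induced_fun.

Lemma inducedE x : induced (cls T x) = cls T' (restr x).
Proof. exact: induced_fun_cls. Qed.
End Induced.

Definition isomorphic (A B : zmodType) : Prop :=
  exists f : {additive A -> B}, bijective f.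

Section Complexes.
Variables (A B C : zmodType) (f : {additive A -> B}) (g : {additive B -> C}).

Definition is_complex : Prop := forall a, g (f a) = 0.
Definition exact_left : Prop := forall a, f a = 0 -> a = 0.
Definition exact_middle : Prop := forall b, g b = 0 <-> exists a, f a = b.
Definition exact_right : Prop := forall c, exists b, g b = c.

Definition short_exact : Prop := [/\ exact_left, exact_middle & exact_right].

Definition split_exact : Prop :=
  short_exact /\ exists s : {additive C -> B}, forall c, g (s c) = c.

Definition homology : zmodType := subquot (ker g) (im f).
End Complexes.

Section Primary.
Variables (p : nat) (A : zmodType).

Definition primary : {pred A} := fun x => `[< exists k, x *+ (p ^ k) = 0 >].

Lemma primary_zmod_closed : zmod_closed primary.
Proof.
split=> [|x y /asboolP[k xk] /asboolP[l yl]]; apply/asboolP.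
  by exists 0%N; rewrite mul0rn.
exists (k + l)%N; rewrite mulrnBl expnD mulrnA xk mul0rn mulnC mulrnA yl mul0rn.
by rewrite subr0.
Qed.
HB.instance Definition _ := GRing.isZmodClosed.Build A primary primary_zmod_closed.

Definition Syl : zmodType := sub_of primary.
End Primary.

Definition basis (X : finType) (u : X) : {ffun X -> int} :=
  [ffun x => (x == u)%:R].

Section Linear.
Variables (X Y : finType) (c : X -> {ffun Y -> int}).

(* The linear map sending the basis vector of [a] to [c a], and its transpose. *)
Definition lin (x : {ffun X -> int}) : {ffun Y -> int} := \sum_a c a *~ x a.
Definition linT (y : {ffun Y -> int}) : {ffun X -> int} :=
  [ffun a => \sum_b c a b * y b].

Lemma lin_is_zmod_morphism : zmod_morphism lin.
Proof.
move=> x y; rewrite /lin -sumrB; apply: eq_bigr => a _.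
by rewrite !ffunE mulrzBr.
Qed.
HB.instance Definition _ := GRing.isZmodMorphism.Build _ _ lin lin_is_zmod_morphism.

Lemma linT_is_zmod_morphism : zmod_morphism linT.
Proof.
move=> x y; apply/ffunP => a; rewrite !ffunE -sumrB; apply: eq_bigr => b _.
by rewrite !ffunE mulrBr.
Qed.
HB.instance Definition _ :=
  GRing.isZmodMorphism.Build _ _ linT linT_is_zmod_morphism.
End Linear.

(* [src] and [tgt] record the ends of an edge together with an orientation. *)
Record mgraph (V E : finType) := MGraph {
  src : E -> V;
  tgt : E -> V;
  half : pred E;
  half_loop : forall e, half e -> src e = tgt e
}.

(* [neg e] holds when the sign of [e] is [-1]. *)
Record sgraph (V E : finType) := SGraph {
  under :> mgraph V E;
  neg : pred E
}.

Section Graphs.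
Variables (V E : finType).

Definition adj (G : mgraph V E) : rel V := fun u v =>
  [exists e, ((src G e, tgt G e) == (u, v)) || ((src G e, tgt G e) == (v, u))].

Definition ncomp (G : mgraph V E) : nat := n_comp (adj G) V.

(* In particular a connected graph has at least one vertex. *)
Definition connected (G : mgraph V E) : Prop := ncomp G = 1%N.

(* A dart [(e, r)] is the edge [e], traversed backwards when [r] holds. *)
Definition dart_src (G : mgraph V E) (d : E * bool) : V :=
  if d.2 then tgt G d.1 else src G d.1.
Definition dart_tgt (G : mgraph V E) (d : E * bool) : V :=
  if d.2 then src G d.1 else tgt G d.1.

(* Distinctness of the edges excludes going back and forth along one edge;
   a loop, or a pair of parallel edges, is a cycle. *)
Definition is_cycle (G : mgraph V E) (c : seq (E * bool)) : bool :=
  [&& c != [::],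
      cycle (fun d d' => dart_tgt G d == dart_src G d') c,
      uniq (map (dart_src G) c)
    & uniq (map fst c)].

Variable G : sgraph V E.

Definition balanced_cycle (c : seq (E * bool)) : bool :=
  ~~ odd (count (fun d => neg G d.1) c).

Definition balanced : Prop :=
  forall c, is_cycle G c -> balanced_cycle c.

Definition sign (e : E) : int := (-1) ^+ neg G e.

Definition bd_col (e : E) : {ffun V -> int} :=
  basis (src G e) - basis (tgt G e) *~ sign e.

Definition delta_col (e : E) : {ffun V -> int} :=
  if half G e && neg G e then basis (src G e) else bd_col e.

Definition bd : {additive {ffun E -> int} -> {ffun V -> int}} := lin bd_col.
Definition deltaT : {additive {ffun V -> int} -> {ffun E -> int}} := linT delta_col.
Definition laplacian : {additive {ffun V -> int} -> {ffun V -> int}} :=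
  bd \o deltaT.

Definition critical_group : zmodType := subquot (im bd) (im laplacian).
End Graphs.

Section Double.
Variables (V E : finType) (G : mgraph V E) (neg1 neg2 : pred E).

Definition disagree (e : E) : bool := neg1 e (+) neg2 e.

(* The half-loops covered by a single edge. *)
Definition merged (e : E) : bool := half G e && disagree e.

(* The vertices [(v, false)] and [(v, true)] are [v_+] and [v_-]; the edges
   [inl (e, false)], [inl (e, true)] and [inr e] are [e_+], [e_-] and [e~]. *)
Definition dvertex : finType := (V * bool)%type.
Definition dedge : finType :=
  ({e : E | ~~ merged e} * bool + {e : E | merged e})%type.

Definition dbase (x : dedge) : E :=
  match x with inl (e, _) => val e | inr e => val e end.

Definition dsrc (x : dedge) : dvertex :=
  match x with
  | inl (e, s) => (src G (val e), s)
  | inr e => (src G (val e), false)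
  end.

Definition dtgt (x : dedge) : dvertex :=
  match x with
  | inl (e, s) => (tgt G (val e), s (+) disagree (val e))
  | inr e => (tgt G (val e), true)
  end.

Definition dhalf (x : dedge) : bool :=
  match x with inl (e, _) => half G (val e) | inr _ => false end.

Lemma dhalf_loop x : dhalf x -> dsrc x = dtgt x.
Proof.
case: x => [[[e ne] s]|] //= he; rewrite (half_loop he).
by move: ne; rewrite /merged he /= => /negbTE->; rewrite addbF.
Qed.

Definition Double : sgraph dvertex dedge :=
  SGraph (MGraph dhalf_loop) (fun x => neg1 (dbase x)).

Definition pi1_col (w : dvertex) : {ffun V -> int} := basis w.1.
Definition pi2_col (w : dvertex) : {ffun V -> int} := basis w.1 *~ ((-1) ^+ w.2).

Definition pi1T : {additive {ffun V -> int} -> {ffun dvertex -> int}} :=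
  linT pi1_col.
Definition pi2 : {additive {ffun dvertex -> int} -> {ffun V -> int}} :=
  lin pi2_col.
End Double.

Section LinearLemmas.
Variables (X Y : finType).

Lemma ffunMzE (f : {ffun X -> int}) (m : int) a : (f *~ m) a = f a * m.
Proof.
rewrite -[m in RHS]intz mulrzr; case: m => n.
  by rewrite -!pmulrn ffunMnE.
by rewrite NegzE !mulrNz -!pmulrn ffunE ffunMnE.
Qed.

Lemma basisE (u v : X) : basis u v = (v == u)%:R.
Proof. exact: ffunE. Qed.

Lemma linE (c : X -> {ffun Y -> int}) x b : lin c x b = \sum_a c a b * x a.
Proof.
rewrite /lin sum_ffunE; apply: eq_bigr => a _.
case: (x a) => n; first by rewrite -pmulrn ffunMnE -mulr_natr natz.
by rewrite NegzE mulrNz -pmulrn ffunE ffunMnE -mulr_natr natz mulrN.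
Qed.

Lemma lin_basis (c : X -> {ffun Y -> int}) a : lin c (basis a) = c a.
Proof.
apply/ffunP => b; rewrite linE (bigD1 a) //= ffunE eqxx mulr1.
by rewrite big1 ?addr0 // => i /negbTE ia; rewrite ffunE ia mulr0.
Qed.

Lemma linMz (c : X -> {ffun Y -> int}) x m : lin c (x *~ m) = lin c x *~ m.
Proof. exact: raddfMz. Qed.

Lemma linT_basis (c : X -> {ffun Y -> int}) b a : linT c (basis b) a = c a b.
Proof.
rewrite ffunE (bigD1 b) //= ffunE eqxx mulr1.
by rewrite big1 ?addr0 // => i /negbTE ib; rewrite ffunE ib mulr0.
Qed.


Lemma linT_edge (c : X -> {ffun Y -> int}) u v (m : int) a :
  linT c (basis u - basis v *~ m) a = c a u - c a v * m.
Proof.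
by rewrite raddfB raddfMz /= [LHS]ffunE [in X in _ + X]ffunE ffunMzE !linT_basis.
Qed.

Lemma edgeE (u v : X) (m : int) w :
  (basis u - basis v *~ m) w = (w == u)%:R - (w == v)%:R * m.
Proof. by rewrite [LHS]ffunE [in X in _ + X]ffunE ffunMzE !basisE. Qed.
End LinearLemmas.

Section LinearCompositions.
Variables (X Y Z : finType).

Lemma lin_lin (c : X -> {ffun Y -> int}) (d : Y -> {ffun Z -> int}) x :
  lin d (lin c x) = lin (fun a => lin d (c a)) x.
Proof.
rewrite {2}/lin raddf_sum /=; apply: eq_bigr => a _; exact: raddfMz.
Qed.

Lemma linT_linT (c : X -> {ffun Y -> int}) (d : Y -> {ffun Z -> int}) y :
  linT c (linT d y) = linT (fun a => lin d (c a)) y.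
Proof.
apply/ffunP => a; rewrite !ffunE.
under eq_bigr => b _ do rewrite ffunE mulr_sumr.
rewrite exchange_big; apply: eq_bigr => z _ /=.
rewrite linE mulr_suml; apply: eq_bigr => b _; ring.
Qed.

Lemma linT_lin (c : Y -> {ffun Z -> int}) (d : X -> {ffun Z -> int}) x :
  linT c (lin d x) = lin (fun a => linT c (d a)) x.
Proof.
rewrite {2}/lin raddf_sum /=; apply: eq_bigr => a _; exact: raddfMz.
Qed.

Lemma lin_linT (c : X -> {ffun Y -> int}) (d : X -> {ffun Z -> int}) y :
  lin d (linT c y) = lin (fun b => lin d (linT c (basis b))) y.
Proof.
apply/ffunP => z; rewrite !linE.
under [RHS]eq_bigr => b _ do rewrite linE mulr_suml.
rewrite exchange_big; apply: eq_bigr => a _ /=.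
rewrite ffunE mulr_sumr; apply: eq_bigr => b _; rewrite linT_basis; ring.
Qed.

Lemma eq_lin (c d : X -> {ffun Y -> int}) x : c =1 d -> lin c x = lin d x.
Proof. by move=> cd; apply: eq_bigr => a _; rewrite cd. Qed.

Lemma eq_linT (c d : X -> {ffun Y -> int}) y : c =1 d -> linT c y = linT d y.
Proof. by move=> cd; apply/ffunP => a; rewrite !ffunE cd. Qed.
End LinearCompositions.

Section InducedMaps.
Variables (V E : finType) (G : mgraph V E) (neg1 neg2 : pred E).

Let G1 := SGraph G neg1.
Let G2 := SGraph G neg2.
Let Gt := Double G neg1 neg2.
Let dE := dedge G neg1 neg2.

Lemma sum_dedge (F : dE -> int) (e : E) :
    (forall x, dbase x != e -> F x = 0) ->
  (exists h, \sum_x F x = F (inr (exist _ e h))) \/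
  (exists h, \sum_x F x =
     F (inl (exist _ e h, false)) + F (inl (exist _ e h, true))).
Proof.
move=> F0; case/orP: (orbN (merged G neg1 neg2 e)) => h; [left|right]; exists h.
  rewrite (bigD1 (inr (exist _ e h))) //= big1 ?addr0 // => x nx.
  apply: F0; apply: contraNneq nx; case: x => [[[e' h'] s]|[e' h']] /= ee.
    by case/negP: h'; rewrite ee.
  by apply/eqP; congr inr; apply: val_inj.
rewrite (bigD1 (inl (exist _ e h, false))) //=.
rewrite (bigD1 (inl (exist _ e h, true))) /=; last by apply/eqP; case.
rewrite big1 ?addr0 //.
move=> x /andP[n1 n2]; apply: F0; apply/eqP.
case: x n1 n2 => [[[e' h'] s]|[e' h']] /= n1 n2 ee; last by case/negP: h; rewrite -ee.
have eqe: exist _ e' h' = exist _ e h :> {e | ~~ merged G neg1 neg2 e} by apply: val_inj.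
by move: n1 n2; rewrite eqe; case: s; rewrite eqxx.
Qed.

Let lift1 (x : dE) : {ffun E -> int} :=
  match x with
  | inl (e, _) => basis (val e)
  | inr e => basis (val e) *~ (if neg1 (val e) then 2 else 0)
  end.

Let lift2 (x : dE) : {ffun E -> int} :=
  match x with
  | inl (e, s) => basis (val e) *~ ((-1) ^+ s)
  | inr e => basis (val e) *~ (neg2 (val e))
  end.

Lemma pi1T_bd x : pi1T V (bd G1 x) = bd Gt (linT lift1 x).
Proof.
rewrite /pi1T /bd /= linT_lin lin_linT; apply: eq_lin => e.
apply/ffunP => w; rewrite linE.
under eq_bigr => y _ do rewrite linT_basis.
case: (@sum_dedge (fun y => bd_col Gt y w * lift1 y e) e) => [y|[h ->]|[h ->]].
- by case: y => [[e' s]|e'] /= ne; rewrite ?ffunMzE basisE eq_sym (negbTE ne) ?mul0r mulr0.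
- have /andP[he] := h; have := half_loop he; case: w => v s; rewrite /disagree.
  rewrite linT_edge /bd_col /sign /= edgeE ffunMzE !basisE !xpair_eqE /= => <-.
  case: (neg1 e) (neg2 e) s => [] [] [] //= _;
    rewrite ?(eqxx, andbT, andbF, mulr1n, mulr0n) ?(eq_sym (src _ _) v)
      ?(eq_sym (tgt _ _) v); ring.
- case: w => v s.
  rewrite linT_edge /bd_col /sign /= !edgeE !basisE !xpair_eqE /= eqxx /disagree.
  case: (neg1 e) (neg2 e) s => [] [] [] /=;
    rewrite ?(andbT, andbF, mulr1n, mulr0n) ?(eq_sym (src _ _) v)
      ?(eq_sym (tgt _ _) v); ring.
Qed.

Lemma deltaT_pi1T y : deltaT Gt (pi1T V y) = linT lift1 (deltaT G1 y).
Proof.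
rewrite /deltaT /pi1T /= !linT_linT; apply: eq_linT => x.
case: x => [[e s]|e] /=; rewrite ?raddfMz /= lin_basis.
- rewrite /delta_col /bd_col /sign /=; case: ifP => _;
  by rewrite ?raddfB ?raddfMz /= !lin_basis.
- have /andP[he] := valP e; rewrite /delta_col /bd_col /sign /= he /disagree.
  rewrite raddfB raddfMz /= !lin_basis /pi1_col /= -(half_loop he).
  by case: (neg1 _) => //= _; apply/ffunP => v; do !rewrite ?ffunMzE ?ffunE /=; ring.
Qed.

Lemma pi2_bd x : pi2 V (bd Gt x) = bd G2 (lin lift2 x).
Proof.
rewrite /pi2 /bd /= !lin_lin; apply: eq_lin => y.
rewrite /bd_col /sign /= raddfB raddfMz /= !lin_basis /pi2_col.
case: y => [[e s]|e] /=; rewrite linMz lin_basis /bd_col /sign /=.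
  apply/ffunP => v; do !rewrite ?ffunMzE ?ffunE /=; rewrite /disagree.
  case: s (neg1 _) (neg2 _) => [] [] [] /=; ring.
have /andP[he] := valP e; rewrite /disagree -(half_loop he) => nn.
apply/ffunP => v; do !rewrite ?ffunMzE ?ffunE /=.
by case: (neg1 _) (neg2 _) nn => [] [] //= _; ring.
Qed.

Lemma deltaT_pi2 y : deltaT G2 (pi2 V y) = lin lift2 (deltaT Gt y).
Proof.
rewrite /pi2 /deltaT /= linT_lin lin_linT; apply: eq_lin => w.
apply/ffunP => e; rewrite linE.
under eq_bigr => x _ do rewrite linT_basis.
case: (@sum_dedge (fun x => lift2 x e * delta_col Gt x w) e) => [x|[h ->]|[h ->]].
- by case: x => [[e' s]|e'] /= ne; rewrite ffunMzE basisE eq_sym (negbTE ne) !mul0r.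
- have /andP[he] := h; rewrite /disagree.
  rewrite /pi2_col raddfMz ffunMzE /= linT_basis; case: w => v s.
  rewrite /delta_col /bd_col /sign /= he -(half_loop he).
  case: (neg1 e) (neg2 e) => [] [] //= _;
    rewrite ?edgeE ffunMzE !basisE !xpair_eqE;
  case: s => /=; rewrite ?(eqxx, andbT, andbF, mulr1n, mulr0n) ?(eq_sym (src _ _) v)
      ?(eq_sym (tgt _ _) v); ring.
- rewrite /pi2_col raddfMz ffunMzE /= linT_basis; case: w => v s.
  rewrite /delta_col /bd_col /sign /=; have := h; rewrite /merged /disagree.
  case: (half G e) (neg1 e) (neg2 e) => [] [] [] //= _;
    rewrite ?edgeE !ffunMzE !basisE !xpair_eqE;
  case: s => /=; rewrite ?(eqxx, andbT, andbF, mulr1n, mulr0n) ?(eq_sym (src _ _) v)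
      ?(eq_sym (tgt _ _) v); ring.
Qed.

Lemma pi1T_im_bd x : x \in im (bd G1) -> pi1T V x \in im (bd Gt).
Proof. by case/imP => y <-; apply/imP; exists (linT lift1 y); rewrite pi1T_bd. Qed.

Lemma pi1T_im_laplacian x :
  x \in im (laplacian G1) -> pi1T V x \in im (laplacian Gt).
Proof.
case/imP => y <-; apply/imP; exists (pi1T V y).
by rewrite /laplacian /= deltaT_pi1T pi1T_bd.
Qed.

Lemma pi2_im_bd x : x \in im (bd Gt) -> pi2 V x \in im (bd G2).
Proof. by case/imP => y <-; apply/imP; exists (lin lift2 y); rewrite pi2_bd. Qed.

Lemma pi2_im_laplacian x :
  x \in im (laplacian Gt) -> pi2 V x \in im (laplacian G2).
Proof.
case/imP => y <-; apply/imP; exists (pi2 V y).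
by rewrite /laplacian /= deltaT_pi2 pi2_bd.
Qed.

(* By [inducedE] these send the class of [x] to that of [pi1T V x], resp.
   [pi2 V x]. *)
Definition K_pi1T : {additive critical_group G1 -> critical_group Gt} :=
  induced pi1T_im_bd pi1T_im_laplacian.

Definition K_pi2 : {additive critical_group Gt -> critical_group G2} :=
  induced pi2_im_bd pi2_im_laplacian.
End InducedMaps.

(* Main.v *)
From HB Require Import structures.
From mathcomp Require Import all_boot all_order all_algebra.
From mathcomp Require Import boolp ring.
Require Import Defs.

(** Write [L1], [L2] and [L] for the Laplacians of the two signed graphs and of
    their double cover. The projections satisfy [pi1 pi1T = 2], [pi2 pi2T = 2],
    [pi2 pi1T = 0] and [pi1T pi1 + pi2T pi2 = 2], and all four of them commute
    with the Laplacians and preserve images of boundary maps. For [pi1] and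
    [pi2T], the commutation with Laplacians is the transpose of that for [pi1T]
    and [pi2], since Laplacians are symmetric. The third identity makes the
    sequence a complex; and as 2 is invertible on odd primary components, the
    identities, together with [pi1 pi2T = 0], give the Sylow decomposition at
    once ([K_Syl]).

    The right-hand map is onto because the edges of the second graph lift
    ([K_exact_right]). Modulo the image of [L], an element of the cover sent by
    [pi2] into the image of [L2] is of the form [pi1T y]. So exactness in the
    middle amounts to comparing two conditions: [pi1T y] is a boundary in the
    cover, and [y] is a boundary in the first graph ([exact_middleP]). On the left,
    the question is whether [pi1T x = L y] implies that [x] is in the image of
    [L1] ([exact_leftP]).

    In a connected graph, the boundaries are the vectors of coordinate sum zero
    when all edges are positive ([im_bd_pos]), and those of even sum when no
    switching makes all edges positive ([im_bd_unbalanced]).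

    - If the cover is disconnected, its components meet each fibre once
      ([sheets_of_disconnected]) and the two signatures differ by switching.
      Restriction to one component is a retraction of [pi1T] compatible with
      boundaries and Laplacians, which gives everything ([K_split_of_sheets]).
    - If the cover is connected and balanced, the first graph is positive, so
      is the cover, and vanishing of the coordinate sum can be tested before or
      after applying [pi1T]. Left exactness is a parity argument
      ([pos_exact_left]).
    - If the cover is connected and unbalanced, so are the two graphs, as
      potentials lift to the cover. Then [L2] is injective, which gives left
      exactness. The vectors [pi1T y] have even sum and are all boundaries,
      whereas [y] is one only if its own sum is even: this leaves a homology
      group of order 2 ([unbal_homology]). *)

Set Implicit Arguments.
Unset Strict Implicit.
Unset Printing Implicit Defensive.

Import GRing.Theory Num.Theory.
Local Open Scope ring_scope.

(** * Subquotients and exact sequences of abelian groups *)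

Section SubquotTheory.
Variables (A : zmodType) (S T : zmodClosed A).

Lemma cls_ind (P : subquot S T -> Prop) :
  (forall x (xS : x \in S), P (cls T (SubOf xS))) -> forall c, P c.
Proof. by move=> Pcls c; rewrite -(cls_surj c); case: (repr _). Qed.

Lemma cls_eq0 x (xS : x \in S) : cls T (SubOf xS) = 0 <-> x \in T.
Proof.
rewrite -(raddf0 (@cls A S T)); split=> [/eqP|xT]; first by rewrite cls_eq subr0.
by apply/eqP; rewrite cls_eq subr0.
Qed.

Lemma cls_congr x y (xS : x \in S) (yS : y \in S) :
  cls T (SubOf xS) = cls T (SubOf yS) <-> x - y \in T.
Proof. by split=> [/eqP|xyT]; [|apply/eqP]; rewrite cls_eq. Qed.
End SubquotTheory.

Lemma inj_surj_bij (X : choiceType) (Y : Type) (h : X -> Y) :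
  injective h -> (forall y, exists x, h x = y) -> bijective h.
Proof.
move=> h_inj /choice[k hK]; exists k => // x.
by apply: h_inj; rewrite hK.
Qed.

(** The splitting lemma. Every [c] has a unique preimage killed by the
    retraction [r]; uniqueness is what makes this section additive. *)
Lemma retraction_splits (A B C : zmodType) (f : {additive A -> B})
    (g : {additive B -> C}) (r : {additive B -> A}) :
  cancel f r -> short_exact f g -> split_exact f g.
Proof.
move=> rK fg; split=> //; case: fg => _ mid surj.
have /choice[s sP] : forall c, exists b, g b = c /\ r b = 0.
  move=> c; have [b gb] := surj c; exists (b - f (r b)).
  have gf : g (f (r b)) = 0 by apply/mid; exists (r b).
  by rewrite !raddfB /= gb gf rK !subr0 subrr.
have s_uniq b b' : g b = g b' -> r b = r b' -> b = b'.
  move=> gbb rbb; apply/eqP; rewrite -subr_eq0; apply/eqP.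
  have /mid[a fa] : g (b - b') = 0 by rewrite raddfB /= gbb subrr.
  by rewrite -fa -(rK a) fa raddfB /= rbb subrr raddf0.
have s_add : zmod_morphism s.
  move=> c d; have [gc rc] := sP c; have [gd rd] := sP d.
  have [gcd rcd] := sP (c - d).
  by apply: s_uniq; rewrite raddfB /= ?gcd ?gc ?gd // rcd rc rd subr0.
pose sM := GRing.isZmodMorphism.Build _ _ s s_add.
pose s' : {additive C -> B} := HB.pack s sM.
by exists s' => c; have [] := sP c.
Qed.

(** If [h0 + h0] were [h0] then [h0] would vanish, so the addition table is
    forced. *)
Lemma two_elements_Z2 (H : zmodType) (h0 : H) :
  h0 != 0 -> (forall h, h = 0 \/ h = h0) -> isomorphic H 'Z_2.
Proof.
move=> h0N H2; pose f (h : H) : 'Z_2 := if h == 0 then 0 else 1.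
have h02 : h0 + h0 = 0.
  case: (H2 (h0 + h0)) => // /eqP; rewrite -subr_eq0 addrK => /eqP h00.
  by rewrite h00 eqxx in h0N.
have f_add : zmod_morphism f.
  move=> x y; rewrite /f; case: (H2 x) (H2 y) => [->|->] [->|->];
    rewrite ?subrr ?subr0 ?sub0r ?oppr_eq0 ?eqxx ?(negbTE h0N) //; exact: val_inj.
pose fM := GRing.isZmodMorphism.Build _ _ f f_add.
pose f' : {additive H -> 'Z_2} := HB.pack f fM.
exists f'; apply: inj_surj_bij => [x y|z] /=; rewrite /f.
  by case: (H2 x) (H2 y) => [->|->] [->|->]; rewrite ?eqxx ?(negbTE h0N).
case: z => [[|[|//]]] ltz2; [exists 0|exists h0].
  by rewrite eqxx; exact: val_inj.
by rewrite (negbTE h0N); exact: val_inj.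
Qed.

(** * Odd primary components *)

Section OddPrimary.
Variable p : nat.

Section SylMap.
Variables (A B : zmodType) (h : {additive A -> B}).

Lemma primary_raddf x : x \in @primary p A -> h x \in @primary p B.
Proof.
by move=> /asboolP[k xk]; apply/asboolP; exists k; rewrite -raddfMn /= xk raddf0.
Qed.

Definition Syl_map (x : Syl p A) : Syl p B := SubOf (primary_raddf (sub_valP x)).

Lemma Syl_map_zmod_morphism : zmod_morphism Syl_map.
Proof. by move=> x y; apply: sub_val_inj; rewrite raddfB /= !raddfB. Qed.
HB.instance Definition _ :=
  GRing.isZmodMorphism.Build _ _ Syl_map Syl_map_zmod_morphism.
End SylMap.

Hypothesis p_odd : odd p.

Lemma Syl_double_inj (A : zmodType) (x : Syl p A) : x *+ 2 = 0 -> x = 0.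
Proof.
move=> x2; apply: sub_val_inj; rewrite raddf0.
have {}x2 : sub_val x *+ 2 = 0 by rewrite -raddfMn x2 raddf0.
have /asboolP[k xk] := sub_valP x; rewrite -xk -[(p ^ k)%N]odd_double_half.
by rewrite oddX p_odd orbT mulrnDr -mul2n mulrnA x2 mul0rn addr0.
Qed.

(** If [p ^ k] kills [y] then half of the even number [p ^ k + 1] divides [y]
    by two. *)
Lemma Syl_double_surj (A : zmodType) (y : Syl p A) : exists x, x *+ 2 = y.
Proof.
have /asboolP[k yk] := sub_valP y; exists (y *+ (p ^ k).+1./2).
rewrite -mulrnA muln2 even_halfK /= ?oddX ?p_odd ?orbT // mulrS.
suff -> : y *+ (p ^ k) = 0 by rewrite addr0.
by apply: sub_val_inj; rewrite raddfMn raddf0.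
Qed.

(** The maps [(f, g)] and [f' + g'] compose, in both orders, to
    multiplication by 2, which is invertible on elements of odd order. *)
Lemma Syl_iso_of_double (A B C : zmodType)
    (f : {additive A -> B}) (g : {additive A -> C})
    (f' : {additive B -> A}) (g' : {additive C -> A}) :
    (forall b, f (f' b) = b *+ 2) -> (forall c, g (g' c) = c *+ 2) ->
    (forall b, g (f' b) = 0) -> (forall c, f (g' c) = 0) ->
    (forall a, f' (f a) + g' (g a) = a *+ 2) ->
  isomorphic (Syl p A) (Syl p B * Syl p C)%type.
Proof.
move=> ff gg gf fg fgE.
pose h (a : Syl p A) : (Syl p B * Syl p C)%type := (Syl_map f a, Syl_map g a).
have h_add : zmod_morphism h by move=> x y; rewrite /h !raddfB.
pose hM := GRing.isZmodMorphism.Build _ _ h h_add.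
pose h' : {additive Syl p A -> (Syl p B * Syl p C)%type} := HB.pack h hM.
exists h'; apply: inj_surj_bij.
  apply: raddf_inj => a /= [fa ga]; apply: Syl_double_inj; apply: sub_val_inj.
  by rewrite raddfMn raddf0 -fgE fa ga !raddf0 addr0.
move=> [b c]; have [b' <-] := Syl_double_surj b; have [c' <-] := Syl_double_surj c.
exists (Syl_map f' b' + Syl_map g' c').
congr pair; apply: sub_val_inj; rewrite /= !raddfD !raddfMn /=.
  by rewrite ff fg addr0.
by rewrite gf gg add0r.
Qed.
End OddPrimary.

(** * Pairings of integer vectors *)

Lemma ffun_double_inj (X : finType) (x y : {ffun X -> int}) :
  x *+ 2 = y *+ 2 -> x = y.
Proof.
move=> /ffunP xy; apply/ffunP => i; have := xy i; rewrite !ffunMnE => /eqP.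
by rewrite eqrMn2r => /eqP.
Qed.

Lemma int_parity (q : int) : exists m, q = m *+ 2 \/ q = m *+ 2 + 1.
Proof.
exists (q %/ 2)%Z; have := divz_eq q 2.
have := modz_ge0 q (isT : 2 != 0 :> int); have := ltz_pmod q (isT : 0 < 2 :> int).
move: (q %/ 2)%Z (q %% 2)%Z => m [[|[|//]]|//] _ _ ->; [left|right]; ring.
Qed.

Section Dot.
Variable X : finType.

Definition dot (x y : {ffun X -> int}) : int := \sum_i x i * y i.

Lemma dotC x y : dot x y = dot y x.
Proof. by apply: eq_bigr => i _; rewrite mulrC. Qed.

Lemma dotBl x y z : dot (x - y) z = dot x z - dot y z.
Proof.
by rewrite /dot -sumrB; apply: eq_bigr => i _; rewrite !ffunE mulrBl.
Qed.

Lemma dotDr z x y : dot z (x + y) = dot z x + dot z y.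
Proof.
by rewrite /dot -big_split; apply: eq_bigr => i _; rewrite !ffunE mulrDr.
Qed.

Lemma dotMzl (x y : {ffun X -> int}) (m : int) : dot (x *~ m) y = dot x y * m.
Proof.
by rewrite /dot mulr_suml; apply: eq_bigr => i _; rewrite ffunMzE mulrAC.
Qed.

Lemma dot_basis x i : dot (basis i) x = x i.
Proof.
rewrite /dot (bigD1 i) //= basisE eqxx mul1r big1 ?addr0 // => j /negbTE ji.
by rewrite basisE ji mul0r.
Qed.

Lemma dot_inj x y : (forall z, dot z x = dot z y) -> x = y.
Proof. by move=> xy; apply/ffunP => i; rewrite -!dot_basis. Qed.
End Dot.

Lemma dot_lin (X Y : finType) (c : X -> {ffun Y -> int}) x y :
  dot (lin c x) y = dot x (linT c y).
Proof.
rewrite /dot; under eq_bigr => b _ do rewrite linE mulr_suml.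
rewrite exchange_big; apply: eq_bigr => a _ /=.
by rewrite ffunE mulr_sumr; apply: eq_bigr => b _; ring.
Qed.

Lemma linTE (X Y : finType) (c : X -> {ffun Y -> int}) y a :
  linT c y a = dot (c a) y.
Proof. exact: ffunE. Qed.

Lemma sum_basis (X : finType) (x : {ffun X -> int}) :
  x = \sum_i basis i *~ x i.
Proof.
apply: dot_inj => z; rewrite /dot; apply: eq_bigr => i _; congr (_ * _).
rewrite sum_ffunE (bigD1 i) //= big1 ?addr0 ?ffunMzE ?basisE ?eqxx ?mul1r //.
by move=> j /negbTE ji; rewrite ffunMzE basisE eq_sym ji mul0r.
Qed.

(** * Laplacians of signed graphs *)

Section SignedGraph.
Variables (V E : finType) (G : sgraph V E).

(** The matrices of [bd] and [delta] differ by this diagonal matrix, which makes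
    the Laplacian a weighted Gram matrix: symmetric and positive semidefinite. *)
Definition bd_weight (e : E) : int := if half G e && neg G e then 2 else 1.

Lemma bd_colE e : bd_col G e = delta_col G e *~ bd_weight e.
Proof.
rewrite /delta_col /bd_weight; case: ifP => // /andP[he ne].
by rewrite /bd_col /sign ne -(half_loop he) mulrNz opprK.
Qed.

Lemma linT_bd_col y e :
  linT (bd_col G) y e = bd_weight e * deltaT G y e.
Proof.
rewrite !ffunE mulr_sumr; apply: eq_bigr => v _.
by rewrite bd_colE ffunMzE; ring.
Qed.

Lemma dot_laplacian x y :
  dot (laplacian G x) y = \sum_e bd_weight e * deltaT G x e * deltaT G y e.
Proof.
rewrite /laplacian /= dot_lin; apply: eq_bigr => e _.
by rewrite linT_bd_col mulrCA mulrA.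
Qed.

Lemma laplacian_sym x y : dot (laplacian G x) y = dot x (laplacian G y).
Proof.
rewrite [RHS]dotC !dot_laplacian; apply: eq_bigr => e _; ring.
Qed.

(** The pairing of [L z] with [z] is a weighted sum of squares, so [L z = 0]
    forces [deltaT z = 0]; the transpose of [bd] is a rescaling of [deltaT]. *)
Lemma ker_laplacian_orth z w :
  laplacian G z = 0 -> w \in im (bd G) -> dot w z = 0.
Proof.
move=> Lz /imP[x <-]; rewrite /bd /= dot_lin; apply: big1 => e _.
have := dot_laplacian z z; rewrite Lz {1}/dot big1; last first.
  by move=> i _; rewrite ffunE mul0r.
move/esym/eqP; rewrite psumr_eq0 => [/allP/(_ e)|i _]; last first.
  by rewrite -mulrA mulr_ge0 -?expr2 ?sqr_ge0 // /bd_weight; case: ifP.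
rewrite mem_index_enum => /(_ isT).
rewrite -mulrA -expr2 mulf_eq0 expf_eq0 /= linT_bd_col => /orP[|/eqP->].
  by rewrite /bd_weight; case: ifP.
by rewrite !mulr0.
Qed.

Lemma bd_col_im e : bd_col G e \in im (bd G).
Proof. by apply/imP; exists (basis e); rewrite /bd /= lin_basis. Qed.

Lemma laplacian_im_bd x : laplacian G x \in im (bd G).
Proof. by apply/imP; exists (deltaT G x). Qed.

Lemma laplacian_im x : laplacian G x \in im (laplacian G).
Proof. by apply/imP; exists x. Qed.
End SignedGraph.

Lemma lin_im_bd (V E X : finType) (G : sgraph V E) (c : X -> {ffun V -> int}) x :
  (forall a, c a \in im (bd G)) -> lin c x \in im (bd G).
Proof. by move=> cG; apply: rpred_sum => a _; apply: rpredMz. Qed.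

Lemma deltaTE (V E : finType) (G : sgraph V E) y e : deltaT G y e =
  if half G e && neg G e then y (src G e)
  else y (src G e) - (-1) ^+ neg G e * y (tgt G e).
Proof.
rewrite /deltaT /= linTE /delta_col /bd_col /sign; case: ifP => _.
  exact: dot_basis.
by rewrite dotBl dotMzl !dot_basis mulrC.
Qed.

(** The coordinate sum of a column of [bd] is [1] minus a sign. *)
Lemma dot_im_even (V E : finType) (G : sgraph V E) w :
  w \in im (bd G) -> exists k, dot w [ffun=> 1] = k *+ 2.
Proof.
case/imP => x <-; rewrite /bd /= dot_lin.
exists (\sum_(e | neg G e) x e); rewrite -sumrMnl.
rewrite [RHS]big_mkcond; apply: eq_bigr => e _ /=.
rewrite linTE dotBl dotMzl !dot_basis !ffunE /sign.
by case: (neg G e) => /=; ring.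
Qed.

Lemma dot_im_pos (V E : finType) (G : sgraph V E) w :
  (forall e, ~~ neg G e) -> w \in im (bd G) -> dot w [ffun=> 1] = 0.
Proof.
move=> pos /imP[x <-]; rewrite /bd /= dot_lin; apply: big1 => e _ /=.
rewrite linTE dotBl dotMzl !dot_basis !ffunE /sign.
by rewrite (negbTE (pos e)) mulr1 subrr mulr0.
Qed.

Lemma laplacian_const (V E : finType) (G : sgraph V E) :
  (forall e, ~~ neg G e) -> laplacian G [ffun=> 1] = 0.
Proof.
move=> pos; rewrite /laplacian /=.
suff -> : linT (delta_col G) [ffun=> 1] = 0 by rewrite raddf0.
apply/ffunP => e; rewrite linTE /delta_col (negbTE (pos e)) andbF ffunE.
exact: dot_im_pos pos (bd_col_im G e).
Qed.

(** * Connectivity *)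

Section Connected.
Variables (V E : finType) (G : mgraph V E).

Lemma adj_sym : symmetric (adj G).
Proof. by move=> u v; apply: eq_existsb => e; rewrite orbC. Qed.

Lemma adj_edge e : adj G (src G e) (tgt G e).
Proof. by apply/existsP; exists e; rewrite eqxx. Qed.

Lemma connectedP :
  connected G <-> exists v0, forall v, connect (adj G) v0 v.
Proof.
have csym := sym_connect_sym adj_sym.
split=> [/mem_card1[r rP]|[v0 cv0]]; last first.
  rewrite /connected /ncomp -(n_comp_connect csym v0); apply: eq_n_comp_r => v.
  by rewrite [RHS]cv0.
exists r => v; rewrite -(root_connect csym).
have root_r u : fingraph.root (adj G) u = r.
  by apply/eqP; rewrite -[_ == r]/(_ \in pred1 r) -rP inE andbT (roots_root csym).
by rewrite !root_r.
Qed.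

(** Walking along edges, as an induction principle over the vertices. *)
Lemma connect_invariant (P : V -> Prop) v0 :
    connected G -> P v0 -> (forall e, P (src G e) <-> P (tgt G e)) ->
  forall v, P v.
Proof.
have csym := sym_connect_sym adj_sym.
case/connectedP=> r cr P0 Pe v; pose a : pred V := fun v => `[< P v >].
have a_closed : closed (adj G) a.
  apply: (intro_closed csym) => x y /existsP[e] /orP[] /eqP[<- <-];
    by rewrite !unfold_in => /asboolP/Pe/asboolP.
have /(closed_connect a_closed) : connect (adj G) v0 v.
  by apply: connect_trans (cr v); rewrite csym.
by rewrite !unfold_in => PvE; apply/asboolP; rewrite -PvE; apply/asboolP.
Qed.

(** Think of [R] as a set of points of the double cover of [G] given by [t], that
    is closed under moving along edges. Either its fibre over some vertex is full,
    and then so are all fibres, or it picks one point over each vertex and hence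
    trivialises the cover. The lemma is used twice: for the sign cover, with [R]
    the congruence to [+-v0] modulo the image of [bd], and for [Double], with [R]
    a connected component. *)
Lemma sheets_dichotomy (R : V -> bool -> Prop) (t : pred E) v0 :
    connected G -> R v0 false ->
    (forall e b, R (src G e) b <-> R (tgt G e) (b (+) t e)) ->
  (forall v b, R v b) \/
    exists eta : pred V, forall e, eta (src G e) (+) eta (tgt G e) = t e.
Proof.
move=> Gc R0 Re; have Re' e b : R (src G e) (b (+) t e) <-> R (tgt G e) b.
  by rewrite (Re e) addbK.
have [[r Rr]|R1] := pselect (exists v, forall b, R v b).
  left; apply: (connect_invariant Gc Rr) => e.
  by split=> Ra b; [apply/Re'|apply/Re]; apply: Ra.
right.
have /choice[eta etaP] : forall v, exists b, R v b.
  apply: (connect_invariant Gc (v0 := v0)) => [|e]; first by exists false.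
  by split=> -[b Rb]; exists (b (+) t e); [apply/Re|apply/Re'].
exists eta => e; apply/eqP; apply: contra_notT R1 => neq; exists (src G e).
have Rs : R (src G e) (~~ eta (src G e)).
  have /Re' := etaP (tgt G e); congr R.
  by move: neq; case: (eta _) (eta _) (t e) => [] [] [].
by move=> b; case: b (eta _) Rs (etaP (src G e)) => [] [].
Qed.
End Connected.

(** * The image of the boundary map *)

(** Switching at the vertices of [s] makes all edges positive. *)
Definition potential (V E : finType) (G : sgraph V E) (s : pred V) : Prop :=
  forall e, s (src G e) (+) s (tgt G e) = neg G e.

(** Along a cycle the signs are differences of the potential, and they
    telescope. *)
Lemma potential_balanced (V E : finType) (G : sgraph V E) s :
  potential G s -> balanced G.
Proof.
move=> Gs [|d c]; rewrite /balanced_cycle // => /and4P[_ + _ _].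
have dartE d' : neg G d'.1 = s (dart_src G d') (+) s (dart_tgt G d').
  by case: d' => e []; rewrite /dart_src /dart_tgt /= -Gs // addbC.
(* The closing dart of the cycle is kept as a fixed endpoint [z]. *)
suff telescope z : forall c d,
    path (fun d d' => dart_tgt G d == dart_src G d') d (rcons c z) ->
  odd (count (fun d' => neg G d'.1) (d :: c)) =
    s (dart_src G d) (+) s (dart_src G z).
  by move/telescope ->; rewrite addbb.
elim=> [|d2 c' IH] d1 /=; rewrite ?andbT.
  by move/eqP <-; rewrite addn0 oddb dartE.
case/andP=> /eqP d12 /IH; rewrite oddD oddb /= => ->.
by rewrite dartE d12 addbA addbK.
Qed.

Section ImageBd.
Variables (V E : finType) (G : sgraph V E).
Hypothesis Gconn : connected G.

Lemma im_bd_pos w : (forall e, ~~ neg G e) ->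
  dot w [ffun=> 1] = 0 -> w \in im (bd G).
Proof.
move=> pos w0; have /connectedP[v0 _] := Gconn.
have base v : basis v - basis v0 \in im (bd G).
  move: v; apply: (connect_invariant Gconn (v0 := v0)) => [|e].
    by rewrite subrr rpred0.
  have := bd_col_im G e; rewrite /bd_col /sign (negbTE (pos e)) mulr1z => eG.
  by rewrite -(subrKA (basis (tgt G e))) rpredDl.
suff -> : w = \sum_v (basis v - basis v0) *~ w v.
  by apply: rpred_sum => v _; apply: rpredMz.
rewrite {1}[w]sum_basis; under [RHS]eq_bigr => v _ do rewrite mulrzBl.
rewrite sumrB -mulrz_sumr.
suff -> : \sum_v w v = 0 by rewrite mulr0z subr0.
by rewrite -[RHS]w0; apply: eq_bigr => v _; rewrite ffunE mulr1.
Qed.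

(** Modulo the image of [bd], every vertex is congruent to [v0] or to [- v0]. If
    each were congruent to only one of the two, the choice would be a potential;
    so twice a vertex lies in the image, and with the differences of vertices
    this generates all vectors of even coordinate sum. *)
Lemma im_bd_unbalanced : (forall s, ~ potential G s) ->
  (forall v, basis v *+ 2 \in im (bd G)) /\
  (forall w k, dot w [ffun=> 1] = k *+ 2 -> w \in im (bd G)).
Proof.
move=> unbal; have /connectedP[v0 _] := Gconn.
pose R v (b : bool) : Prop := basis v - basis v0 *~ (-1) ^+ b \in im (bd G).
have signP (b : bool) x : x *~ (-1) ^+ b \in im (bd G) <-> x \in im (bd G).
  by case: b; rewrite ?mulrNz mulr1z ?rpredN.
have Re e b : R (src G e) b <-> R (tgt G e) (b (+) neg G e).
  rewrite /R -(signP (neg G e) (basis (tgt G e) - _)).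
  rewrite mulrzBl -mulrzA signr_addb -mulrA -expr2 sqrr_sign mulr1.
  have -> : basis (src G e) - basis v0 *~ (-1) ^+ b =
      bd_col G e + (basis (tgt G e) *~ (-1) ^+ neg G e - basis v0 *~ (-1) ^+ b).
    by rewrite /bd_col /sign addrA subrK.
  by rewrite rpredDl ?bd_col_im.
have R0 : R v0 false by rewrite /R mulr1z subrr rpred0.
have [Rall|[s /unbal//]] := sheets_dichotomy Gconn R0 Re.
have base v : basis v - basis v0 \in im (bd G).
  by have := Rall v false; rewrite /R mulr1z.
have even v : basis v *+ 2 \in im (bd G).
  have := rpredD (base v) (Rall v true).
  by rewrite mulrNz mulr1z opprK addrACA addNr addr0 -mulr2n.
split=> // w k wk.
suff -> : w = \sum_v (basis v - basis v0) *~ w v + basis v0 *+ 2 *~ k.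
  by rewrite rpredD ?rpredMz //; apply: rpred_sum => v _; apply: rpredMz.
rewrite {1}[w]sum_basis; under [in RHS]eq_bigr => v _ do rewrite mulrzBl.
rewrite sumrB -mulrz_sumr.
suff -> : \sum_v w v = k *+ 2 by rewrite -mulr_natl natz mulrzA -pmulrn subrK.
by rewrite -wk; apply: eq_bigr => v _; rewrite ffunE mulr1.
Qed.
End ImageBd.

(** * The two projections *)

Section Projections.
Variable V : finType.

Definition pi1 : {additive {ffun dvertex V -> int} -> {ffun V -> int}} :=
  lin (@pi1_col V).
Definition pi2T : {additive {ffun V -> int} -> {ffun dvertex V -> int}} :=
  linT (@pi2_col V).

(** Both [pi1] and [pi2] have this form, with [m] equal to [1] and to the sign of
    the sheet. *)
Lemma lin_sheets (m : dvertex V -> int) x v :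
  lin (fun w => basis w.1 *~ m w) x v =
    m (v, false) * x (v, false) + m (v, true) * x (v, true).
Proof.
transitivity (\sum_u \sum_(b : bool) (basis u *~ m (u, b)) v * x (u, b)).
  by rewrite linE pair_bigA; apply: eq_bigr => -[].
rewrite (bigD1 v) //= big_bool /= !ffunMzE !basisE eqxx !mul1r addrC.
by rewrite big1 ?add0r 1?addrC // => u /negbTE uv; rewrite big_bool /= !ffunMzE
  !basisE eq_sym uv !mul0r addr0.
Qed.

Lemma pi1E x v : pi1 x v = x (v, false) + x (v, true).
Proof.
have := lin_sheets (fun=> 1) x v; rewrite !mul1r => <-.
apply: (congr1 (fun f : {ffun V -> int} => f v)).
by apply: eq_lin => w; rewrite mulr1z.
Qed.

Lemma pi2E x v : pi2 V x v = x (v, false) - x (v, true).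
Proof. by rewrite /pi2 /= lin_sheets /= mul1r mulN1r. Qed.

Lemma pi1TE x w : pi1T V x w = x w.1.
Proof. by rewrite /pi1T /= linTE dot_basis. Qed.

Lemma pi2TE x w : pi2T x w = x w.1 * (-1) ^+ w.2.
Proof. by rewrite /pi2T /= linTE dotMzl dot_basis. Qed.

Lemma dot_pi1 x y : dot (pi1 x) y = dot x (pi1T V y).
Proof. exact: dot_lin. Qed.

Lemma dot_pi2 x y : dot (pi2 V x) y = dot x (pi2T y).
Proof. exact: dot_lin. Qed.

Lemma pi1_pi1T x : pi1 (pi1T V x) = x *+ 2.
Proof. by apply/ffunP => v; rewrite pi1E !pi1TE ffunMnE mulr2n. Qed.

Lemma dot_pi1T_one x : dot (pi1T V x) [ffun=> 1] = dot x [ffun=> 1] *+ 2.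
Proof.
rewrite dotC -dot_pi1; have -> : pi1 [ffun=> 1] = [ffun=> 1] *+ 2.
  by apply/ffunP => v; rewrite pi1E ffunMnE !ffunE.
by rewrite mulr2n dotC dotDr -mulr2n.
Qed.

Lemma pi2_pi2T x : pi2 V (pi2T x) = x *+ 2.
Proof.
by apply/ffunP => v; rewrite pi2E !pi2TE ffunMnE mulr2n mulr1 mulrN1 opprK.
Qed.

Lemma pi2_pi1T x : pi2 V (pi1T V x) = 0.
Proof. by apply/ffunP => v; rewrite pi2E !pi1TE ffunE subrr. Qed.

Lemma pi1_pi2T x : pi1 (pi2T x) = 0.
Proof. by apply/ffunP => v; rewrite pi1E !pi2TE ffunE mulr1 mulrN1 subrr. Qed.

Lemma pi1T_pi1_pi2T_pi2 x : pi1T V (pi1 x) + pi2T (pi2 V x) = x *+ 2.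
Proof.
apply/ffunP => -[v b]; rewrite ffunE pi1TE pi2TE pi1E pi2E ffunMnE.
by case: b => /=; ring.
Qed.

Lemma ker_pi2 x : pi2 V x = 0 -> exists y, x = pi1T V y.
Proof.
move=> /ffunP x0; exists [ffun v => x (v, false)]; apply/ffunP => -[v b].
rewrite pi1TE ffunE; case: b => //; apply/esym/eqP; rewrite -subr_eq0 -pi2E x0.
by rewrite ffunE.
Qed.

Lemma pi2_surj y : exists x, pi2 V x = y.
Proof.
exists [ffun w => if w.2 then 0 else y w.1].
by apply/ffunP => v; rewrite pi2E !ffunE subr0.
Qed.

Lemma pi1T_inj : injective (pi1T V).
Proof.
by move=> x y /ffunP xy; apply/ffunP => v; have := xy (v, false); rewrite !pi1TE.
Qed.
End Projections.

(** * Critical groups of a double cover *)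

Section DoubleCover.
Variables (V E : finType) (G : mgraph V E) (neg1 neg2 : pred E).

Let G1 := SGraph G neg1.
Let G2 := SGraph G neg2.
Let Gt := Double G neg1 neg2.

Lemma pi1T_laplacian y : pi1T V (laplacian G1 y) = laplacian Gt (pi1T V y).
Proof. by rewrite /laplacian /= (deltaT_pi1T _ _ neg2) (pi1T_bd _ _ neg2). Qed.

Lemma pi2_laplacian y : pi2 V (laplacian Gt y) = laplacian G2 (pi2 V y).
Proof. by rewrite /laplacian /= (deltaT_pi2 _ neg1) pi2_bd. Qed.

(** Transpose of [pi1T_laplacian]: both Laplacians are symmetric. *)
Lemma pi1_laplacian y : pi1 V (laplacian Gt y) = laplacian G1 (pi1 V y).
Proof.
apply: dot_inj => z; rewrite dotC dot_pi1 laplacian_sym -pi1T_laplacian.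
by rewrite -dot_pi1 -laplacian_sym dotC.
Qed.

(** Transpose of [pi2_laplacian]. *)
Lemma pi2T_laplacian y : pi2T V (laplacian G2 y) = laplacian Gt (pi2T V y).
Proof.
apply: dot_inj => z; rewrite -dot_pi2 -laplacian_sym -pi2_laplacian dot_pi2.
exact: laplacian_sym.
Qed.

Lemma pi1_bd_col a : pi1 V (bd_col Gt a) = bd_col G1 (dbase a).
Proof.
rewrite /bd_col /sign raddfB raddfMz /= !lin_basis /pi1_col.
by case: a => [[e s]|e].
Qed.

(** Each column of the boundary of the second graph lifts to a single edge of the
    cover. This is why the right-hand map is always onto. *)
Lemma pi2_bd_col_lift e : exists a, pi2 V (bd_col Gt a) = bd_col G2 e.
Proof.
have [h|h] := boolP (merged G neg1 neg2 e).
  exists (inr (exist _ e h)); have /andP[he] := h; rewrite /disagree => dis.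
  rewrite /bd_col /sign raddfB raddfMz /= !lin_basis /pi2_col -(half_loop he) /=.
  by case: (neg1 e) (neg2 e) dis => [] [] //= _;
    rewrite ?mulrNz !mulr1z ?mulrNz opprK.
exists (inl (exist _ e h, false)).
rewrite /bd_col /sign raddfB raddfMz /= !lin_basis /pi2_col /disagree /=.
by case: (neg1 e) (neg2 e) => [] []; rewrite /= ?mulrNz !mulr1z ?mulrNz ?opprK.
Qed.

Lemma pi2T_bd_col_im e : pi2T V (bd_col G2 e) \in im (bd Gt).
Proof.
have [h|h] := boolP (merged G neg1 neg2 e).
  have -> : pi2T V (bd_col G2 e) =
      bd_col Gt (inr (exist _ e h)) *~ (if neg2 e then 2 else 0).
    have /andP[he] := h; rewrite /disagree => dis; apply/ffunP => -[v b].
    rewrite pi2TE ffunMzE /bd_col /sign !edgeE /= -(half_loop he) !xpair_eqE.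
    by case: (neg1 e) (neg2 e) dis b => [] [] //= _ [] /=;
      rewrite ?(andbT, andbF, mulr0n); ring.
  by apply: rpredMz; apply: bd_col_im.
have -> : pi2T V (bd_col G2 e) =
    bd_col Gt (inl (exist _ e h, false)) - bd_col Gt (inl (exist _ e h, true)).
  apply/ffunP => -[v b]; rewrite pi2TE [RHS]ffunE [in X in _ = _ + X]ffunE.
  rewrite /bd_col /sign !edgeE /= /disagree !xpair_eqE.
  by case: (neg1 e) (neg2 e) b => [] [] [] /=; rewrite ?(andbT, andbF, mulr0n); ring.
by rewrite rpredB ?bd_col_im.
Qed.

Lemma pi1_im_bd x : x \in im (bd Gt) -> pi1 V x \in im (bd G1).
Proof.
case/imP => y <-; rewrite /pi1 /bd /= lin_lin; apply: lin_im_bd => a.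
by rewrite -[lin _ _]/(pi1 V _) pi1_bd_col bd_col_im.
Qed.

Lemma pi1_im_laplacian x :
  x \in im (laplacian Gt) -> pi1 V x \in im (laplacian G1).
Proof. by case/imP => y <-; rewrite pi1_laplacian laplacian_im. Qed.

Lemma pi2T_im_bd x : x \in im (bd G2) -> pi2T V x \in im (bd Gt).
Proof.
case/imP => y <-; rewrite /pi2T /bd /= linT_lin; apply: lin_im_bd => e.
exact: pi2T_bd_col_im.
Qed.

Lemma pi2T_im_laplacian x :
  x \in im (laplacian G2) -> pi2T V x \in im (laplacian Gt).
Proof. by case/imP => y <-; rewrite pi2T_laplacian laplacian_im. Qed.

Lemma pi2_im_bd_surj w :
  w \in im (bd G2) -> exists2 x, x \in im (bd Gt) & pi2 V x = w.
Proof.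
case/imP => y <-; have /choice[a aP] := pi2_bd_col_lift.
exists (lin (fun e => bd_col Gt (a e)) y).
  by apply: lin_im_bd => e; apply: bd_col_im.
by rewrite /pi2 /= lin_lin; apply: eq_lin.
Qed.

Definition K_pi1 : {additive critical_group Gt -> critical_group G1} :=
  induced pi1_im_bd pi1_im_laplacian.

Definition K_pi2T : {additive critical_group G2 -> critical_group Gt} :=
  induced pi2T_im_bd pi2T_im_laplacian.

Let f : {additive critical_group G1 -> critical_group Gt} := K_pi1T G neg1 neg2.
Let g : {additive critical_group Gt -> critical_group G2} := K_pi2 G neg1 neg2.

Lemma K_complex : is_complex f g.
Proof.
elim/cls_ind => x xS; rewrite !(inducedE _ _ (SubOf xS)) !inducedE; apply/cls_eq0.
by rewrite /= pi2_pi1T rpred0.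
Qed.

Lemma K_exact_right : exact_right g.
Proof.
elim/cls_ind => w wS; have [x xS xw] := pi2_im_bd_surj wS.
exists (cls _ (SubOf xS)); rewrite inducedE; apply/cls_congr.
by rewrite /= xw subrr rpred0.
Qed.

(** Besides [f] and [g], the transposed maps [pi1] and [pi2T] act on critical
    groups, and together they invert one another up to a factor of 2. *)
Lemma K_Syl p : odd p -> isomorphic (Syl p (critical_group Gt))
  (Syl p (critical_group G1) * Syl p (critical_group G2))%type.
Proof.
move=> p_odd; apply: (Syl_iso_of_double p_odd
  (f := K_pi1) (g := g) (f' := f) (g' := K_pi2T)).
- elim/cls_ind => x xS; rewrite !(inducedE _ _ (SubOf xS)) !inducedE -raddfMn.
  by apply/eqP; rewrite cls_eq raddfMn /= pi1_pi1T subrr rpred0.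
- elim/cls_ind => x xS; rewrite !(inducedE _ _ (SubOf xS)) !inducedE -raddfMn.
  by apply/eqP; rewrite cls_eq raddfMn /= pi2_pi2T subrr rpred0.
- exact: K_complex.
- elim/cls_ind => x xS; rewrite !(inducedE _ _ (SubOf xS)) !inducedE; apply/cls_eq0.
  by rewrite /= pi1_pi2T rpred0.
- elim/cls_ind => x xS; rewrite !(inducedE _ _ (SubOf xS)) !inducedE.
  rewrite -raddfMn -raddfD; apply/eqP.
  by rewrite cls_eq raddfD raddfMn /= pi1T_pi1_pi2T_pi2 subrr rpred0.
Qed.

(** Left exactness and, below, exactness in the middle are reduced to questions
    about integer vectors, which each of the three cases answers differently. *)
Lemma exact_leftP :
  (forall x y, pi1T V x = laplacian Gt y -> x \in im (laplacian G1)) ->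
  exact_left f.
Proof.
move=> inj; elim/cls_ind => x xS; rewrite inducedE => /cls_eq0/imP[y xy].
by apply/cls_eq0; apply: (inj x y).
Qed.

(** If [pi2 x = L2 u], then subtracting from [x] the Laplacian of a preimage of
    [u] under [pi2] leaves an element of the kernel of [pi2], which is the image
    of [pi1T]. *)
Lemma laplacian_pi2_decomp x : pi2 V x \in im (laplacian G2) ->
  exists y z, x = pi1T V y + laplacian Gt z.
Proof.
case/imP => u ux; have [z zu] := pi2_surj u.
have [|y xy] := @ker_pi2 _ (x - laplacian Gt z).
  by rewrite raddfB /= pi2_laplacian zu ux subrr.
by exists y, z; rewrite -xy subrK.
Qed.

Lemma exact_middleP :
  (forall x, pi1T V x \in im (bd Gt) -> x \in im (bd G1)) -> exact_middle f g.
Proof.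
move=> lift b; split=> [|[a <-]]; last exact: K_complex.
elim/cls_ind: b => x xS; rewrite inducedE.
case/cls_eq0/laplacian_pi2_decomp => y [z xyz].
have yS : y \in im (bd G1).
  apply: lift; rewrite -[pi1T V y](addrK (laplacian Gt z)) -xyz.
  by rewrite rpredB ?laplacian_im_bd.
exists (cls _ (SubOf yS)); rewrite inducedE; apply/cls_congr.
suff : pi1T V y - x \in im (laplacian Gt) by [].
by rewrite [x](xyz : x = _) opprD addrA subrr sub0r rpredN laplacian_im.
Qed.
End DoubleCover.

(** * Switching *)

Section Switching.
Variables (V E : finType) (G : mgraph V E) (neg1 neg2 : pred E) (eta : pred V).

Definition switch (y : {ffun V -> int}) : {ffun V -> int} :=
  [ffun v => (-1) ^+ eta v * y v].

Lemma dot_switch x y : dot (switch x) y = dot x (switch y).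
Proof. by apply: eq_bigr => v _; rewrite !ffunE; ring. Qed.

Hypothesis etaE :
  forall e, eta (src G e) (+) eta (tgt G e) = disagree neg1 neg2 e.

Lemma half_agree e : half G e -> neg1 e = neg2 e.
Proof.
move=> he; have := etaE e; rewrite /disagree (half_loop he) addbb.
by case: (neg1 e) (neg2 e) => [] [].
Qed.

(** Switching is its own inverse, so the two graphs may be exchanged; both
    versions are needed, one for each argument of the Gram matrix. *)
Lemma switch_deltaT y e :
  deltaT (SGraph G neg1) (switch y) e =
    (-1) ^+ eta (src G e) * deltaT (SGraph G neg2) y e /\
  deltaT (SGraph G neg2) (switch y) e =
    (-1) ^+ eta (src G e) * deltaT (SGraph G neg1) y e.
Proof.
have := etaE e; rewrite !deltaTE !ffunE /= /disagree.
have := @half_agree e; case: (half G e) => /=.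
  move=> /(_ isT) ->; case: (neg2 e) (eta _) (eta _) => [] [] [] //= _; split; ring.
move=> _.
case: (neg1 e) (neg2 e) (eta _) (eta _) => [] [] [] [] //= _; split; ring.
Qed.

(** When [eta] accounts for the disagreement of the two signatures, switching at
    [eta] turns one signed graph into the other. *)
Lemma switch_laplacian y :
  switch (laplacian (SGraph G neg2) y) = laplacian (SGraph G neg1) (switch y).
Proof.
apply: dot_inj => z; rewrite dotC dot_switch [RHS]dotC !dot_laplacian.
apply: eq_bigr => e _; have [-> _] := switch_deltaT y e.
have [_ ->] := switch_deltaT z e.
have -> : bd_weight (SGraph G neg2) e = bd_weight (SGraph G neg1) e.
  by rewrite /bd_weight /=; case he: (half G e); rewrite //= half_agree.
ring.
Qed.
End Switching.

(** * The three cases *)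

Section Cases.
Variables (V E : finType) (G : mgraph V E) (neg1 neg2 : pred E).
Hypothesis Gconn : connected G.

Let G1 := SGraph G neg1.
Let G2 := SGraph G neg2.
Let Gt := Double G neg1 neg2.
Let f : {additive critical_group G1 -> critical_group Gt} := K_pi1T G neg1 neg2.
Let g : {additive critical_group Gt -> critical_group G2} := K_pi2 G neg1 neg2.

Section TwoSheets.
Variable eta : pred V.
Hypothesis etaE :
  forall e, eta (src G e) (+) eta (tgt G e) = disagree neg1 neg2 e.

(** Restriction to the component of the cover formed by the vertices
    [(v, eta v)], on which [Double] looks like the first graph. *)
Definition sheet : {additive {ffun dvertex V -> int} -> {ffun V -> int}} :=
  linT (fun v => basis (v, eta v)).

Lemma sheetE x v : sheet x v = x (v, eta v).
Proof. by rewrite /sheet /= linTE dot_basis. Qed.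

Lemma sheet_pi1T x : sheet (pi1T V x) = x.
Proof. by apply/ffunP => v; rewrite sheetE pi1TE. Qed.

(** This formula yields the compatibility of [sheet] with the Laplacians from
    that of [pi1], [pi2] and [switch]. *)
Lemma sheet_double x : sheet x *+ 2 = pi1 V x + switch eta (pi2 V x).
Proof.
apply/ffunP => v; rewrite [RHS]ffunE [in X in _ = _ + X]ffunE pi1E pi2E ffunMnE.
by rewrite sheetE; case: (eta v) => /=; ring.
Qed.

Lemma sheet_laplacian x : sheet (laplacian Gt x) = laplacian G1 (sheet x).
Proof.
apply: ffun_double_inj; rewrite sheet_double -[RHS]raddfMn sheet_double raddfD.
by rewrite pi1_laplacian pi2_laplacian (switch_laplacian etaE).
Qed.

(** No half-loop is merged, because [eta] agrees with itself at both ends; every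
    edge of the cover lies either inside the sheet or away from it. *)
Lemma sheet_bd_col a : sheet (bd_col Gt a) \in im (bd G1).
Proof.
case: a => [[e s]|e]; last first.
  have /andP[he] := valP e.
  by rewrite -etaE (half_loop he) addbb.
have -> : sheet (bd_col Gt (inl (e, s))) =
    bd_col G1 (val e) *~ (if s == eta (src G (val e)) then 1 else 0).
  apply/ffunP => v; rewrite sheetE ffunMzE /bd_col /sign !edgeE /= !xpair_eqE -etaE.
  have [vs|_] := eqVneq v (src G (val e)); have [vt|_] := eqVneq v (tgt G (val e));
    rewrite -?vs -?vt; case: s (eta _) => [] [];
    do ?[by case: (eta _) => /=; ring | by rewrite /=; ring].
by apply: rpredMz; apply: bd_col_im.
Qed.

Lemma sheet_im_bd x : x \in im (bd Gt) -> sheet x \in im (bd G1).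
Proof.
case/imP => y <-; rewrite /sheet /bd /= linT_lin; apply: lin_im_bd.
exact: sheet_bd_col.
Qed.

Lemma sheet_im_laplacian x :
  x \in im (laplacian Gt) -> sheet x \in im (laplacian G1).
Proof. by case/imP => y <-; rewrite sheet_laplacian laplacian_im. Qed.

(** Restriction to a sheet is a retraction of [pi1T], on critical groups too; its
    existence gives exactness at the left and in the middle, and a splitting. *)
Lemma K_split_of_sheets : split_exact f g.
Proof.
apply: (retraction_splits (r := induced sheet_im_bd sheet_im_laplacian)).
  elim/cls_ind => x xS; rewrite (inducedE _ _ (SubOf xS)) inducedE.
  by apply/cls_congr; rewrite /= sheet_pi1T subrr rpred0.
split; last exact: K_exact_right.
  apply: exact_leftP => x y xy.
  by rewrite -(sheet_pi1T x) xy sheet_laplacian laplacian_im.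
by apply: exact_middleP => x /sheet_im_bd; rewrite sheet_pi1T.
Qed.
End TwoSheets.

(** A merged half-loop joins the two points over its vertex. *)
Lemma connect_double e b : connect (adj Gt) (src G e, b)
  (tgt G e, b (+) disagree neg1 neg2 e).
Proof.
have csym := sym_connect_sym (@adj_sym _ _ Gt).
have [h|h] := boolP (merged G neg1 neg2 e); last first.
  exact: connect1 (adj_edge Gt (inl (exist _ e h, b))).
have := connect1 (adj_edge Gt (inr (exist _ e h))) => /=.
have /andP[he ->] := h; rewrite (half_loop he).
by case: b => //=; rewrite csym.
Qed.

(** [R] is the component of [(v0, false)]; if it contains both points over every
    vertex then the cover is connected. *)
Lemma sheets_of_disconnected : ~ connected Gt ->
  exists eta : pred V,
    forall e, eta (src G e) (+) eta (tgt G e) = disagree neg1 neg2 e.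
Proof.
move=> Gt_disc; have /connectedP[v0 _] := Gconn.
have csym := sym_connect_sym (@adj_sym _ _ Gt).
pose R v b := connect (adj Gt) (v0, false) (v, b) : Prop.
have Re e b : R (src G e) b <-> R (tgt G e) (b (+) disagree neg1 neg2 e).
  by rewrite /R -(same_connect_r csym (connect_double e b)).
have [Rall|//] := sheets_dichotomy Gconn (connect0 _ _ : R v0 false) Re.
by case: Gt_disc; apply/connectedP; exists (v0, false) => -[v b]; apply: Rall.
Qed.

Lemma potential_lift1 s :
  potential G1 s -> potential Gt (fun w : dvertex V => s w.1).
Proof. by move=> Gs [[e b]|e]; rewrite -[neg _ _]/(neg G1 (val e)) -Gs. Qed.

(** The cover carries the signs of the first graph, so a potential of the second
    has to be twisted by the sheet. *)
Lemma potential_lift2 s :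
  potential G2 s -> potential Gt (fun w : dvertex V => s w.1 (+) w.2).
Proof.
move=> Gs [[e b]|e] /=; have /= := Gs (val e); rewrite /disagree.
  by case: (s _) (s _) b (neg1 _) (neg2 _) => [] [] [] [] [].
have /andP[_] := valP e; rewrite /disagree.
by case: (s _) (s _) (neg1 _) (neg2 _) => [] [] [] [].
Qed.

Section Positive.
Hypothesis pos : forall e, ~~ neg1 e.

(** If [pi1T x = L y] then [2 x = L1 (pi1 y)], and [pi2 y] is in the kernel of
    [L2], so its absolute value is constant. Hence the entries of [pi1 y], which
    have the same parities as those of [pi2 y], are all congruent modulo 2. As
    all edges are positive, [L1] kills the constants; subtracting a constant
    makes [pi1 y] even, and the factor 2 cancels. *)
Lemma pos_exact_left : exact_left f.
Proof.
apply: exact_leftP => x y xy; have /connectedP[v0 _] := Gconn.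
have Lz : laplacian G2 (pi2 V y) = 0.
  by rewrite -(pi2_laplacian G neg1 neg2) -xy pi2_pi1T.
have /choice[t tE] : forall v, exists k, pi1 V y v = pi1 V y v0 + k *+ 2.
  apply: (connect_invariant Gconn (v0 := v0)) => [|e]; first by exists 0; ring.
  (* Going through an edge changes [pi1 y] by an even number. *)
  suff [k ->] : exists k, pi1 V y (src G e) = pi1 V y (tgt G e) + k *+ 2.
    split=> -[l lE]; first by exists (l - k);
      rewrite -[LHS](addrK (k *+ 2)) lE; ring.
    by exists (l + k); rewrite lE; ring.
  have := ker_laplacian_orth Lz (bd_col_im G2 e).
  rewrite /bd_col dotBl dotMzl !dot_basis !pi1E !pi2E /sign /= => /eqP.
  rewrite subr_eq0 => /eqP; case: (neg2 e) => /= /eqP; rewrite -subr_eq0 => /eqP E0.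
    exists (y (src G e, true) - y (tgt G e, false)); apply/eqP.
    by rewrite -subr_eq0 -[0]E0; apply/eqP; ring.
  exists (y (src G e, true) - y (tgt G e, true)); apply/eqP.
  by rewrite -subr_eq0 -[0]E0; apply/eqP; ring.
have yE : pi1 V y = [ffun=> 1] *~ pi1 V y v0 + [ffun v => t v] *+ 2.
  by apply/ffunP => v; rewrite tE [RHS]ffunE ffunMzE ffunMnE !ffunE mul1r.
apply/imP; exists [ffun v => t v]; apply: ffun_double_inj.
rewrite -[RHS]pi1_pi1T xy pi1_laplacian yE raddfD raddfMn raddfMz.
by rewrite laplacian_const // mul0rz add0r.
Qed.

(** Images of boundary maps of positive graphs have coordinate sum zero, and for
    a connected graph this is the only constraint. *)
Lemma pos_exact_middle : exact_middle f g.
Proof.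
apply: exact_middleP => x xS; apply: im_bd_pos => //.
have := @dot_im_pos _ _ Gt _ (fun a => pos (dbase a)) xS.
by rewrite dot_pi1T_one => /eqP; rewrite mulrn_eq0 => /eqP.
Qed.
End Positive.

Section Unbalanced.
Hypothesis Gtconn : connected Gt.
Hypothesis Gtunbal : ~ balanced Gt.

Lemma unbal_no_potential :
  [/\ forall s, ~ potential G1 s, forall s, ~ potential G2 s &
      forall s, ~ potential Gt s].
Proof.
have Gt0 s : ~ potential Gt s by move/potential_balanced.
by split=> // s; [move/potential_lift1|move/potential_lift2]; apply: Gt0.
Qed.

(** The kernel is orthogonal to the image of [bd], which contains twice each
    vertex. *)
Lemma unbal_ker_laplacian z : laplacian G2 z = 0 -> z = 0.
Proof.
move=> Lz; have [_ pot2 _] := unbal_no_potential.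
have [/= even _] := im_bd_unbalanced (G := G2) Gconn pot2.
apply/ffunP => v; have := ker_laplacian_orth Lz (even v).
rewrite dotC mulr2n dotDr -mulr2n dotC dot_basis ffunE => /eqP.
by rewrite mulrn_eq0 => /eqP.
Qed.

Lemma unbal_laplacian_pi1T x y :
  pi1T V x = laplacian Gt y -> exists z, x = laplacian G1 z.
Proof.
move=> xy; have /ker_pi2[z yz] : pi2 V y = 0.
  by apply: unbal_ker_laplacian; rewrite -(pi2_laplacian G neg1 neg2) -xy pi2_pi1T.
by exists z; apply: pi1T_inj; rewrite xy yz (pi1T_laplacian G neg1 neg2).
Qed.

Lemma unbal_exact_left : exact_left f.
Proof.
by apply: exact_leftP => x y /unbal_laplacian_pi1T[z ->]; apply: laplacian_im.
Qed.

(** The homology is the group of integer vectors modulo the boundaries of [G1]: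
    the classes are represented by [pi1T x], and every [pi1T x] has even sum, hence
    is a boundary in the cover, while [x] is a boundary in the first graph only
    when its own sum is even. The non-trivial class is that of a vertex. *)
Lemma unbal_homology : isomorphic (homology f g) 'Z_2.
Proof.
have /connectedP[v0 _] := Gconn; have [pot1 pot2 pott] := unbal_no_potential.
have [_ /= even1] := im_bd_unbalanced (G := G1) Gconn pot1.
have [_ /= event] := im_bd_unbalanced (G := Gt) Gtconn pott.
have pi1TS x : pi1T V x \in im (bd Gt).
  by apply: (event _ (dot x [ffun=> 1])); rewrite dot_pi1T_one.
pose k x : critical_group Gt := cls _ (SubOf (pi1TS x)).
have kK x : k x \in ker g.
  by apply/eqP; rewrite /k inducedE; apply/cls_eq0; rewrite /= pi2_pi1T rpred0.
have k_im x : k x \in im f <-> x \in im (bd G1).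
  split=> [/imP[]|xS].
    elim/cls_ind => y yS; rewrite inducedE => /cls_congr.
    case/imP => z /esym; rewrite -[X in X = _ -> _]/(pi1T V y - pi1T V x).
    rewrite -raddfB => /unbal_laplacian_pi1T[t yxt].
    by rewrite -[x](subKr y) yxt rpredB ?laplacian_im_bd.
  apply/imP; exists (cls _ (SubOf xS)); rewrite inducedE.
  by apply/cls_congr; rewrite /= subrr rpred0.
have one_odd : basis v0 \notin im (bd G1).
  apply/negP => /dot_im_even[m]; rewrite dot_basis ffunE.
  move/(congr1 (fun z => odd `|z|)).
  by rewrite -mulr_natr abszM oddM andbF.
apply: (two_elements_Z2 (h0 := cls _ (SubOf (kK (basis v0))))).
  by apply/eqP => /cls_eq0/k_im; apply/negP.
elim/cls_ind => c cK.
have [y cy] : exists y, c = k y.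
  move: cK => /eqP; elim/cls_ind: c => x xS; rewrite inducedE.
  case/cls_eq0/(@laplacian_pi2_decomp _ _ G neg1) => y [z xyz].
  by exists y; apply/cls_congr; rewrite [x](xyz : x = _) addrC addKr laplacian_im.
move: cK; rewrite {c}cy => yK.
have [m [my|my]] := int_parity (dot y [ffun=> 1]); [left|right].
  by apply/cls_eq0; apply: (proj2 (k_im y)); apply: even1 my.
have kB : k y - k (basis v0) = k (y - basis v0).
  by rewrite /k -raddfB; apply/eqP; rewrite cls_eq raddfB /= raddfB subrr rpred0.
apply/cls_congr; rewrite kB; apply/k_im; apply: (even1 _ m).
by rewrite dotBl my dot_basis ffunE addrK.
Qed.
End Unbalanced.
End Cases.

Theorem theorem11p6 (V E : finType) (G : mgraph V E) (neg1 neg2 : pred E)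
  (Gconn : connected G)
  (Gpos : connected (Double G neg1 neg2) -> balanced (Double G neg1 neg2) ->
          forall e : E, ~~ neg1 e) :
  let K1 := critical_group (SGraph G neg1) in
  let K2 := critical_group (SGraph G neg2) in
  let Gt := Double G neg1 neg2 in
  let Kt := critical_group Gt in
  let f : {additive K1 -> Kt} := K_pi1T G neg1 neg2 in
  let g : {additive Kt -> K2} := K_pi2 G neg1 neg2 in
  [/\ is_complex f g,
      ncomp Gt = 2%N -> split_exact f g,
      connected Gt -> balanced Gt -> short_exact f g,
      connected Gt -> ~ balanced Gt ->
        [/\ exact_left f, exact_right g & isomorphic (homology f g) 'Z_2]
    & forall p : nat, prime p -> odd p ->
        isomorphic (Syl p Kt) (Syl p K1 * Syl p K2)%type].
Proof.
split.
- exact: K_complex.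
- move=> Gt2; have [|eta etaE] := @sheets_of_disconnected _ _ G neg1 neg2 Gconn.
    by rewrite /connected Gt2.
  exact: K_split_of_sheets etaE.
- move=> Gtc Gtb; have pos := Gpos Gtc Gtb; split.
  + exact: pos_exact_left.
  + exact: pos_exact_middle.
  + exact: K_exact_right.
- move=> Gtc Gtu; split.
  + exact: unbal_exact_left.
  + exact: K_exact_right.
  + exact: unbal_homology.
- by move=> p _; apply: K_Syl.
Qed.
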